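(* Let $\mathcal{A}$ be a unital $C^*$-algebra, $\mathcal{H}$ a Hilbert $\mathcal{A}$-module, $\mathbb{J}\subseteq\mathbb{N}$ a finite or countable index set, and $\{T_i\}_{i\in\mathbb{J}}$ a family of adjointable operators on $\mathcal{H}$. Suppose that $\sum_{i\in\mathbb{J}}\langle T_ix,T_ix\rangle$ converges in norm for all $x\in\mathcal{H}$. Then $\{T_i\}_{i\in\mathbb{J}}$ is an operator frame for $End_{\mathcal{A}}^{*}(\mathcal{H})$ if and only if there exist constants $A,B>0$ such that $$A\|x\|^2\le\Big\|\sum_{i\in\mathbb{J}}\langle T_ix,T_ix\rangle\Big\|\le B\|x\|^2\qquad\text{for all }x\in\mathcal{H}.$$
   Context: Hilbert $\mathcal{A}$-modules are left modules with $\mathcal{A}$-valued inner product $\langle\cdot,\cdot\rangle$, $\mathcal{A}$-linear in the first variable, with $\langle x,y\rangle=\langle y,x\rangle^*$, complete for $\|x\|=\|\langle x,x\rangle\|^{1/2}$. $End_{\mathcal{A}}^{*}(\mathcal{H})$ is the set of adjointable operators on $\mathcal{H}$. Inequalities between elements of $\mathcal{A}$ refer to the usual order given by the positive cone of $\mathcal{A}$. A family $\{T_i\}_{i\in\mathbb{J}}\subset End_{\mathcal{A}}^{*}(\mathcal{H})$ is an operator frame for $End_{\mathcal{A}}^{*}(\mathcal{H})$ if there exist constants $A,B>0$ such that $A\langle x,x\rangle\le\sum_{i\in\mathbb{J}}\langle T_ix,T_ix\rangle\le B\langle x,x\rangle$ in $\mathcal{A}$ for all $x\in\mathcal{H}$.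 (The constants in this definition need not be those in the norm inequality.) *)

(* Defs.v *)
From HB Require Import structures.
From mathcomp Require Import all_boot all_order all_algebra.
From mathcomp Require Import complex.
From mathcomp Require Import boolp classical_sets reals topology normedtype
  sequences.

Set Implicit Arguments.
Unset Strict Implicit.
Unset Printing Implicit Defensive.

Import Order.TTheory GRing.Theory Num.Theory.
Import numFieldNormedType.Exports.

Local Open Scope classical_set_scope.
Local Open Scope complex_scope.
Local Open Scope ring_scope.

(* The scalars are the complex numbers R[i], with R the real numbers.  Norms
   take their values in R[i]: they are nonnegative, hence real, and 0 <= z in
   R[i] means that z is real and nonnegative. *)

(* A unital C*-algebra: a Banach space with a compatible product, unit and
   involution.  The ring operations are fields rather than inherited because
   numDomainType is already a join of normed and ring structures, which prevents
   Hierarchy Builder from declaring a second one. *)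
HB.mixin Record CompleteNormedModule_isCStarAlgebra (R : realType) A
    of CompleteNormedModule R[i] A := {
  csone : A ;
  csmul : A -> A -> A ;
  csmulA : associative csmul ;
  csmul1r : left_id csone csmul ;
  csmulr1 : right_id csone csmul ;
  csmulDl : left_distributive csmul +%R ;
  csmulDr : right_distributive csmul +%R ;
  csscaleAl : forall (z : R[i]) (a b : A), z *: csmul a b = csmul (z *: a) b ;
  csscaleAr : forall (z : R[i]) (a b : A), z *: csmul a b = csmul a (z *: b) ;
  ler_normcsM : forall a b : A, `|csmul a b| <= `|a| * `|b| ;
  star : A -> A ;
  starK : involutive star ;
  starD : {morph star : a b / a + b} ;
  starZ : forall (z : R[i]) (a : A), star (z *: a) = Num.conj z *: star a ;
  starM : forall a b : A, star (csmul a b) = csmul (star b) (star a) ;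
  normcs_star : forall a : A, `|csmul (star a) a| = `|a| ^+ 2 }.

#[short(type="cstarAlgType")]
HB.structure Definition CStarAlgebra (R : realType) :=
  {A of CompleteNormedModule R[i] A & CompleteNormedModule_isCStarAlgebra R A}.

HB.instance Definition _ (R : realType) (A : cstarAlgType R) :=
  GRing.Zmodule_isPzRing.Build A (@csmulA R A) csmul1r csmulr1
    csmulDl csmulDr.

Section Order.
Context {R : realType} {A : cstarAlgType R}.
Implicit Types a b : A.

Definition invertible a := exists b, a * b = 1 /\ b * a = 1.

Definition spectrum a : set R[i] := [set z : R[i] | ~ invertible (z *: (1 : A) - a)].

Definition cspos a := star a = a /\ (forall z, spectrum a z -> 0 <= z).

Definition csle a b := cspos (b - a).

End Order.

(* The complex vector space structure of a module over a unital algebra is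
   determined by the action of A: z x = (z 1) x. *)
HB.mixin Record Lmodule_isPreHilbertModule (R : realType) (A : cstarAlgType R) H
    of GRing.Lmodule A H := {
  inner : H -> H -> A ;
  innerDl : forall x y z : H, inner (x + y) z = inner x z + inner y z ;
  innerZl : forall (a : A) (x y : H), inner (a *: x) y = a * inner x y ;
  inner_star : forall x y : H, inner x y = star (inner y x) ;
  inner_pos : forall x : H, cspos (inner x x) ;
  inner_eq0 : forall x : H, inner x x = 0 -> x = 0 }.

#[short(type="preHilbertModType")]
HB.structure Definition PreHilbertModule (R : realType) (A : cstarAlgType R) :=
  {H of GRing.Lmodule A H & Lmodule_isPreHilbertModule R A H}.

(* H does not carry the normed structures of the library: those are tied to a
   module structure over the scalars, and the one declared here is over A. *)
Definition hnorm (R : realType) (A : cstarAlgType R) (H : preHilbertModType A)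
  (x : H) : R[i] := sqrtC `|inner x x|.

HB.mixin Record PreHilbertModule_isComplete (R : realType) (A : cstarAlgType R) H
    of PreHilbertModule R A H := {
  hnorm_complete : forall u : nat -> H,
    (forall e : R[i], 0 < e -> exists N, forall m n,
       (N <= m)%N -> (N <= n)%N -> hnorm (u m - u n) < e) ->
    exists l : H, forall e : R[i], 0 < e -> exists N, forall n,
       (N <= n)%N -> hnorm (u n - l) < e }.

#[short(type="hilbertModType")]
HB.structure Definition HilbertModule (R : realType) (A : cstarAlgType R) :=
  {H of PreHilbertModule R A H & PreHilbertModule_isComplete R A H}.

Section OperatorFrame.
Context {R : realType} {A : cstarAlgType R} {H : hilbertModType A}.

Definition adjointable (S : H -> H) :=
  exists S' : H -> H, forall x y, inner (S x) y = inner x (S' y).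

(* A family indexed by J is given by a sequence T : nat -> H -> H of which only
   the values on J matter; the terms are summed in the order of nat. *)
Definition frame_psum (J : set nat) (T : nat -> H -> H) (x : H) (n : nat) : A :=
  \sum_(0 <= i < n | i \in J) inner (T i x) (T i x).

(* The norm limit of the partial sums; meaningful only when they converge. *)
Definition frame_sum (J : set nat) (T : nat -> H -> H) (x : H) : A :=
  limn (frame_psum J T x).

Definition operator_frame (J : set nat) (T : nat -> H -> H) :=
  [/\ forall i, J i -> adjointable (T i),
      forall x, cvgn (frame_psum J T x) &
      exists a b : R, [/\ 0 < a, 0 < b &
        forall x, csle (a%:C *: inner x x) (frame_sum J T x) /\
                  csle (frame_sum J T x) (b%:C *: inner x x)]].

End OperatorFrame.

(* Main.v *)
(* Call h positive when it is self-adjoint and |t - h| <= t for some t >= 0.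
   Such elements form a closed convex cone, and h + e = y^2 with y self-adjoint
   for every e > 0, y being obtained as 1 - w from a fixed point of
   w = (k + w^2) / 2.  With the C*-identity and an infimum argument over
   {r >= 0 | h + r positive} this notion agrees with positivity of the spectrum,
   so neither the spectral radius formula nor Gelfand duality is needed.

   The theorem then rests on one principle: if p is self-adjoint, q is positive
   and |c p c| <= K |c q c| for all self-adjoint c, then p <= K q.  Indeed
   c = (q + e)^(-1/2) gives |c p c| <= K, hence c p c <= K and p <= K (q + e).
   Since both <x,x> and the frame sum f(x) satisfy f(c x) = c f(x) c, applying it
   to these two elements in both roles gives the two frame inequalities.  The
   converse is the monotonicity of the norm on positive elements. *)

Require Import Defs.
From mathcomp Require Import all_boot all_order all_algebra.
From mathcomp Require Import complex.
From mathcomp Require Import boolp classical_sets reals topology normedtype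
  sequences.
From mathcomp Require Import ring lra.
Import Order.TTheory GRing.Theory Num.Theory.
Import numFieldNormedType.Exports.
Local Open Scope classical_set_scope.
Local Open Scope complex_scope.
Local Open Scope ring_scope.

(** * Real-valued norm, involution and real scalars *)

Section CStar.
Context {R : realType} {A : cstarAlgType R}.
Implicit Types (a b c h k x y : A) (r s t e : R).

Lemma cs_scaleAl (z : R[i]) a b : (z *: a) * b = z *: (a * b).
Proof. by rewrite [RHS]csscaleAl. Qed.

Lemma cs_scaleAr (z : R[i]) a b : a * (z *: b) = z *: (a * b).
Proof. by rewrite [RHS]csscaleAr. Qed.

(** Norms live in [R[i]], whose order is only partial; the real part loses nothing and gives access
    to the total order of [R]. *)
Definition rnorm a : R := complex.Re `|a|.

Lemma rnormE a : `|a| = (rnorm a)%:C.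
Proof. by rewrite RRe_real ?normr_real. Qed.

Lemma rnorm_ge0 a : 0 <= rnorm a.
Proof. by rewrite -lecR -rnormE; exact: normr_ge0. Qed.

Lemma rnormD a b : rnorm (a + b) <= rnorm a + rnorm b.
Proof. by rewrite -lecR rmorphD /= -!rnormE ler_normD. Qed.

Lemma rnormM a b : rnorm (a * b) <= rnorm a * rnorm b.
Proof. by rewrite -lecR rmorphM /= -!rnormE; exact: ler_normcsM. Qed.

Lemma rnormN a : rnorm (- a) = rnorm a.
Proof. by rewrite /rnorm normrN. Qed.

Lemma rnorm_distC a b : rnorm (a - b) = rnorm (b - a).
Proof. by rewrite -opprB rnormN. Qed.

Lemma rnorm_distD b a c : rnorm (a - c) <= rnorm (a - b) + rnorm (b - c).
Proof. by rewrite -{1}(subrK b a) -addrA rnormD. Qed.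

Lemma rnormZ (z : R[i]) a : rnorm (z *: a) = complex.Re `|z| * rnorm a.
Proof.
by apply: complexI; rewrite -rnormE normrZ rnormE rmorphM.
Qed.

Lemma rnormZr r a : rnorm (r%:C *: a) = `|r| * rnorm a.
Proof. by rewrite rnormZ normc_def /= expr0n addr0 sqrtr_sqr. Qed.

Lemma rnorm0_eq0 a : rnorm a = 0 -> a = 0.
Proof. by move=> a0; apply/eqP; rewrite -normr_eq0 rnormE a0. Qed.

Lemma rnorm0 : rnorm 0 = 0.
Proof. by rewrite /rnorm normr0. Qed.

Lemma rnorm_starM a : rnorm (star a * a) = rnorm a ^+ 2.
Proof.
by apply: complexI; rewrite -rnormE [LHS]normcs_star rnormE rmorphXn.
Qed.

(** The C*-identity gives |b|^2 = |b* b| <= |b*| |b|; cancel |b|, then apply the result to b* as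
    well. *)
Lemma rnorm_star a : rnorm (star a) = rnorm a.
Proof.
have le_star b : rnorm b <= rnorm (star b).
  have := rnorm_ge0 b; rewrite le_eqVlt => /orP[/eqP<-|b0].
    exact: rnorm_ge0.
  by rewrite -(ler_pM2r b0) -expr2 -rnorm_starM rnormM.
by apply/eqP; rewrite eq_le le_star andbT -{2}(starK a) le_star.
Qed.

Lemma star0 : star (0 : A) = 0.
Proof. by apply: (addIr (star 0)); rewrite -starD !add0r. Qed.

Lemma starN a : star (- a) = - star a.
Proof. by apply/eqP; rewrite -addr_eq0 -starD addNr star0. Qed.

Lemma starB a b : star (a - b) = star a - star b.
Proof. by rewrite starD starN. Qed.

Lemma starMr a b : star (a * b) = star b * star a.
Proof. exact: starM. Qed.

Lemma starZr r a : star (r%:C *: a) = r%:C *: star a.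
Proof. by rewrite starZ; congr (_ *: _); exact: conjc_real. Qed.

Lemma star1 : star (1 : A) = 1.
Proof. by rewrite -[RHS]starK -[in RHS](mul1r (star 1)) starMr starK mul1r. Qed.

(** Only an inequality, since in the zero algebra the unit has norm 0. *)
Lemma rnorm1 : rnorm (1 : A) <= 1.
Proof.
have := rnorm_starM (1 : A); rewrite star1 mulr1 => n1.
have := rnorm_ge0 (1 : A); rewrite le_eqVlt => /orP[/eqP <-//|p].
by rewrite -(ler_pM2r p) -expr2 -n1 mul1r.
Qed.

Definition cst r : A := r%:C *: (1 : A).

Lemma cst_mul r a : cst r * a = r%:C *: a.
Proof. by rewrite cs_scaleAl mul1r. Qed.

Lemma mul_cst r a : a * cst r = r%:C *: a.
Proof. by rewrite cs_scaleAr mulr1. Qed.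

Lemma cstD r s : cst (r + s) = cst r + cst s.
Proof. by rewrite /cst rmorphD scalerDl. Qed.

Lemma cstN r : cst (- r) = - cst r.
Proof. by rewrite /cst rmorphN scaleNr. Qed.

Lemma cst1 : cst 1 = 1.
Proof. by rewrite /cst rmorph1 scale1r. Qed.

Lemma cst0 : cst 0 = 0.
Proof. by rewrite /cst rmorph0 scale0r. Qed.

Lemma star_cst r : star (cst r) = cst r.
Proof. by rewrite starZr star1. Qed.

Lemma scale_cst r s : r%:C *: cst s = cst (r * s).
Proof. by rewrite /cst scalerA -rmorphM. Qed.

Lemma rnorm_cst r : rnorm (cst r) <= `|r|.
Proof. by rewrite rnormZr ler_piMr // rnorm1. Qed.

(** * Limits, closed sets and the contraction principle *)

Lemma cauchy_limit (u : nat -> A) :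
  (forall e, 0 < e -> exists N, forall n, rnorm (u (N + n)%N - u N) <= e) ->
  exists l, forall e, 0 < e -> exists N, forall n, (N <= n)%N -> rnorm (u n - l) <= e.
Proof.
move=> u_cauchy.
have : cvgn u.
  apply/cauchy_cvgP/cauchy_exP => e e0.
  have eE : e = (complex.Re e)%:C by rewrite RRe_real // gtr0_real.
  (* Halving turns the non-strict Cauchy bound into the strict one that defines the ball. *)
  have e0' : 0 < complex.Re e / 2 by rewrite divr_gt0 // -ltcR -eE.
  have [N HN] := u_cauchy _ e0'.
  exists (u N); exists N => // n /= Nn; rewrite -ball_normE /=.
  rewrite rnormE eE ltcR -(subnKC Nn) rnorm_distC.
  by apply: le_lt_trans (HN _) _; lra.
move=> /cvgrPdist_le u_lim; exists (limn u) => e e0.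
have [|N _ HN] := u_lim e%:C; first by rewrite ltcR.
by exists N => n Nn; have := HN n Nn; rewrite rnormE lecR rnorm_distC.
Qed.

Lemma limn_rnorm (u : nat -> A) : cvgn u ->
  forall e, 0 < e -> exists N, forall n, (N <= n)%N -> rnorm (u n - limn u) <= e.
Proof.
move=> /cvgrPdist_le u_lim e e0.
have [|N _ HN] := u_lim e%:C; first by rewrite ltcR.
by exists N => n Nn; have := HN n Nn; rewrite rnormE lecR rnorm_distC.
Qed.

Definition rclosed (U : A -> Prop) :=
  forall a, (forall e, 0 < e -> exists2 b, U b & rnorm (b - a) <= e) -> U a.

Lemma le_epsilon r s t : (forall e, 0 < e -> r <= s + t * e) -> r <= s.
Proof.
move=> H; apply/ler_addgt0Pr => e e0.
have t1 : 0 < `|t| + 1 by rewrite ltr_wpDl.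
have := H (e / (`|t| + 1)) (divr_gt0 e0 t1) => /le_trans; apply; rewrite lerD2l.
rewrite mulrCA ler_piMr ?(ltW e0) // ler_pdivrMr // mul1r.
by apply: le_trans (ler_norm t) _; rewrite lerDl.
Qed.

Lemma rnorm_small a t : (forall e, 0 < e -> rnorm a <= t * e) -> a = 0.
Proof.
move=> H; apply: rnorm0_eq0; apply/eqP; rewrite eq_le rnorm_ge0 andbT.
by apply: (@le_epsilon _ _ t) => e e0; rewrite add0r H.
Qed.

Lemma geometric_small r t e : 0 <= r < 1 -> 0 < e -> exists N, r ^+ N * t <= e.
Proof.
move=> /andP[r0 r1] e0.
have : (fun n => r ^+ n) @ \oo --> (0 : R).
  by apply: cvg_expr; rewrite ger0_norm.
move=> /cvgrPdist_le /(_ (e / (`|t| + 1))).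
have t1 : 0 < `|t| + 1 by rewrite ltr_wpDl.
case=> [|N _ /(_ N (leqnn N))] /=; first exact: divr_gt0.
rewrite sub0r normrN ger0_norm ?exprn_ge0 // => rN; exists N.
have le1 : r ^+ N * t <= r ^+ N * (`|t| + 1).
  by rewrite ler_wpM2l ?exprn_ge0 // (le_trans (ler_norm t)) // lerDl.
by apply: le_trans le1 _; rewrite -ler_pdivlMr.
Qed.

(** Banach's contraction principle, iterating from 0. The closed invariant set [U] carries further
    properties over to the fixed point. *)
Lemma rnorm_fixpoint (f : A -> A) (U : A -> Prop) r : 0 <= r < 1 -> U 0 ->
  rclosed U -> (forall a, U a -> U (f a)) ->
  (forall a b, U a -> U b -> rnorm (f a - f b) <= r * rnorm (a - b)) ->
  exists2 l, U l & l = f l.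
Proof.
move=> r01 U0 clU Uf lipf; have /andP[r0 r1] := r01.
(* [C] is the sum of the geometric series with first term |f 0|, so that C = r C + |f 0|; it bounds
   every iterate. *)
pose u n := iter n f 0; pose C := rnorm (f 0) / (1 - r).
have Uu n : U (u n) by elim: n => //= n /Uf.
have C0 n : rnorm (u n - 0) <= C.
  elim: n => [|n IHn] /=.
    by rewrite subrr rnorm0 divr_ge0 ?rnorm_ge0 // subr_ge0 ltW.
  have -> : C = r * C + rnorm (f 0).
    by rewrite /C; field; rewrite subr_eq0 gt_eqF.
  apply: le_trans (rnorm_distD (f 0) _ _) _; rewrite subr0 lerD2r.
  by apply: le_trans (lipf _ _ (Uu n) U0) _; rewrite ler_wpM2l.
have Cn n m : rnorm (u (n + m)%N - u n) <= r ^+ n * C.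
  elim: n => [|n IHn]; first by rewrite add0n expr0 mul1r.
  rewrite addSn /= exprS -mulrA; apply: le_trans (lipf _ _ (Uu _) (Uu _)) _.
  by rewrite ler_wpM2l.
have [|l ul] := @cauchy_limit u.
  move=> e e0; have [N rN] := @geometric_small r C e r01 e0.
  by exists N => n; apply: le_trans (Cn _ _) rN.
have Ul : U l.
  by apply: clU => e /ul[N HN]; exists (u N) => //; exact: HN.
exists l => //; apply/subr0_eq.
(* The two errors are |l - u (N+1)| and |f (u N) - f l|, each at most e. *)
apply: (@rnorm_small _ 2) => e e0; have [N HN] := ul e e0.
apply: le_trans (rnorm_distD (u N.+1) _ _) _.
rewrite rnorm_distC mulr_natl mulr2n; apply: lerD; first exact/HN/leqW.
apply: le_trans (lipf _ _ (Uu _) Ul) _.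
by apply: le_trans (HN _ (leqnn _)); rewrite ler_piMl ?rnorm_ge0 // ltW.
Qed.

End CStar.

(** * Closed conditions, inverses and square roots *)

Section Invertibility.
Context {R : realType} {A : cstarAlgType R}.
Implicit Types (a b c h k x y : A) (r s t e : R).

Lemma rclosed_norm r : rclosed (fun a => rnorm a <= r).
Proof.
move=> a Ha; apply: (@le_epsilon _ _ _ 1) => e /Ha[b br ba].
rewrite mul1r -(subrK b a) addrC; apply: le_trans (rnormD _ _) _.
by rewrite lerD // rnorm_distC.
Qed.

Lemma rclosed_star : rclosed (fun a => star a = a).
Proof.
move=> a Ha; apply: subr0_eq; apply: (@rnorm_small _ _ _ 2) => e /Ha[b bs ba].
apply: le_trans (rnorm_distD b _ _) _; rewrite mulr_natl mulr2n.
by apply: lerD => //; rewrite -{1}bs -starB rnorm_star rnorm_distC.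
Qed.

Lemma rclosed_comm c : rclosed (fun a => GRing.comm c a).
Proof.
move=> a Ha; apply: subr0_eq.
apply: (@rnorm_small _ _ _ (2 * rnorm c)) => e /Ha[b bs ba].
apply: le_trans (rnorm_distD (c * b) _ _) _; rewrite {2}bs -mulrBr -mulrBl.
rewrite -mulrA mulr_natl mulr2n; apply: lerD.
  by apply: le_trans (rnormM _ _) _; rewrite ler_wpM2l ?rnorm_ge0 // rnorm_distC.
by apply: le_trans (rnormM _ _) _; rewrite mulrC ler_wpM2l ?rnorm_ge0.
Qed.

Lemma comm_scale (z : R[i]) a b : GRing.comm a b -> GRing.comm a (z *: b).
Proof. by move=> ab; rewrite /GRing.comm cs_scaleAl cs_scaleAr ab. Qed.

Lemma comm_cst a r : GRing.comm a (cst r).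
Proof. exact/comm_scale/commr1. Qed.

(** The Neumann series in fixed-point form: u = 1 + k u is a right inverse, v = 1 + v k a left
    inverse, and the two coincide. *)
Lemma invertible_neumann k : rnorm k < 1 -> invertible (1 - k).
Proof.
move=> k1; have k01 : 0 <= rnorm k < 1 by rewrite rnorm_ge0.
have clT : rclosed (fun _ : A => True) by [].
have [u _ uE] : exists2 u, True & u = 1 + k * u.
  apply: (@rnorm_fixpoint _ _ _ (fun=> True) _ k01) => // a b _ _.
  by rewrite opprD addrACA subrr add0r -mulrBr rnormM.
have [v _ vE] : exists2 v, True & v = 1 + v * k.
  apply: (@rnorm_fixpoint _ _ _ (fun=> True) _ k01) => // a b _ _.
  by rewrite opprD addrACA subrr add0r -mulrBl mulrC rnormM.
have ku : (1 - k) * u = 1 by rewrite mulrBl mul1r {1}uE addrK.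
have vk : v * (1 - k) = 1 by rewrite mulrBr mulr1 {1}vE addrK.
have uv : u = v by rewrite -[u]mul1r -vk -mulrA ku mulr1.
by exists u; rewrite {2}uv.
Qed.

Lemma invertible_scale (z : R[i]) a : z != 0 -> invertible a -> invertible (z *: a).
Proof.
move=> z0 [b [ab ba]]; exists (z^-1 *: b).
by rewrite !cs_scaleAl !cs_scaleAr !scalerA ab ba mulfV // mulVf // !scale1r.
Qed.

Lemma invertible_mul a b : invertible a -> invertible b -> invertible (a * b).
Proof.
move=> [a' [aa' a'a]] [b' [bb' b'b]]; exists (b' * a').
by rewrite mulrA -(mulrA a) bb' mulr1 aa' mulrA -(mulrA b') a'a mulr1 b'b.
Qed.

(** If c inverts ab = ba, then bc is a right inverse of a and cb a left one, hence they are
    equal. *)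
Lemma comm_invertible a b : GRing.comm a b -> invertible (a * b) -> invertible a.
Proof.
move=> ab [c [abc cab]]; exists (b * c); rewrite mulrA; split => //.
have cba : c * b * a = 1 by rewrite -mulrA -ab.
have abc1 : a * (b * c) = 1 by rewrite mulrA.
by rewrite -[b * c]mul1r -{1}cba -(mulrA _ a) abc1 mulr1.
Qed.

Lemma star_inv a b : a * b = 1 -> b * a = 1 -> star a = a -> star b = b.
Proof.
move=> ab ba sa; rewrite -[LHS]mulr1 -ab mulrA -{1}sa -starMr ab star1.
by rewrite mul1r.
Qed.

Lemma sqrt_1B k : star k = k -> rnorm k < 1 ->
  exists y, [/\ star y = y, y * y = 1 - k & forall c, GRing.comm c k -> GRing.comm c y].
Proof.
move=> sk k1; have k01 : 0 <= rnorm k < 1 by rewrite rnorm_ge0.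
(* On the ball of radius |k|, [f] contracts with constant |k| because a^2 - b^2 = a (a - b) + (a -
   b) b. The last clause puts the root in the bicommutant of k. *)
pose U w := [/\ star w = w, rnorm w <= rnorm k & forall c, GRing.comm c k -> GRing.comm c w].
pose f w := (2^-1)%:C *: (k + w * w).
have [|||a b|w [sw _ cw] wE] := @rnorm_fixpoint _ _ f U _ k01.
- split; [exact: star0 | by rewrite rnorm0 rnorm_ge0 | by move=> c _; exact: commr0].
- move=> a Ha; split.
  + by apply: rclosed_star => e /Ha[b [? _ _]] ?; exists b.
  + by apply: rclosed_norm => e /Ha[b [_ ? _]] ?; exists b.
  + by move=> c ck; apply: rclosed_comm => e /Ha[b [_ _ /(_ c ck) ?]] ?; exists b.
- move=> w [sw kw cw]; split.
  + by rewrite starZr starD starMr sk sw.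
  + rewrite rnormZr ger0_norm ?invr_ge0 // mulrC ler_pdivrMr //.
    rewrite mulr_natr mulr2n; apply: le_trans (rnormD _ _) _; rewrite lerD2l.
    apply: le_trans (rnormM _ _) _; apply: le_trans (kw).
    by rewrite ler_piMr ?rnorm_ge0 // (le_trans kw) // ltW.
  + by move=> c ck; apply/comm_scale/commrD => //; apply: commrM; exact: cw.
- move=> [sa ka ca] [sb kb cb].
  rewrite -scalerBr rnormZr ger0_norm ?invr_ge0 // mulrC ler_pdivrMr //.
  rewrite opprD addrACA subrr add0r.
  have -> : a * a - b * b = a * (a - b) + (a - b) * b.
    by rewrite mulrBr mulrBl addrA subrK.
  apply: le_trans (rnormD _ _) _; rewrite mulr_natr mulr2n.
  apply: lerD; apply: le_trans (rnormM _ _) _.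
    by rewrite ler_wpM2r ?rnorm_ge0.
  by rewrite mulrC ler_wpM2r ?rnorm_ge0.
have wwE : w + w = k + w * w.
  rewrite {1 2}wE /f -scalerDl -rmorphD /=.
  have -> : 2^-1 + 2^-1 = 1 :> R by field.
  by rewrite rmorph1 scale1r.
exists (1 - w); split.
- by rewrite starB star1 sw.
- have -> : k = w + w - w * w by rewrite wwE addrK.
  by rewrite mulrBr mulr1 mulrBl mul1r !opprB opprD -addrA [X in 1 + X]addrCA.
- by move=> c ck; apply: commrB; [exact: commr1 | exact: cw].
Qed.

(* For commuting self-adjoint elements x^2 + y^2 = (x + iy)^* (x + iy), and
   x is the real part of x + iy. *)
Lemma rnorm_sqr_le x y : star x = x -> star y = y -> GRing.comm x y ->
  rnorm x ^+ 2 <= rnorm (x * x + y * y).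
Proof.
move=> sx sy xy; pose i : R[i] := 'i; pose w := x + i *: y.
have ii : i * i = -1 by rewrite -expr2 sqrCi.
have sw : star w = x - i *: y.
  by rewrite starD starZ sx sy conjCi scaleNr.
have -> : x * x + y * y = star w * w.
  rewrite sw mulrBl !mulrDr cs_scaleAr !cs_scaleAl cs_scaleAr scalerA ii.
  by rewrite xy scaleN1r opprD opprK addrA addrK.
have x2 : x + x = w + star w by rewrite sw addrACA subrr addr0.
rewrite rnorm_starM ler_sqr ?nnegrE ?rnorm_ge0 //.
have := rnormD w (star w); rewrite -x2 rnorm_star.
have -> : x + x = 2%:C *: x by rewrite rmorph_nat scaler_nat mulr2n.
by rewrite rnormZr ger0_norm // -mulr2n mulr_natl ler_pMn2r.
Qed.

End Invertibility.

(** * The cone of positive elements *)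

Section Positivity.
Context {R : realType} {A : cstarAlgType R}.
Implicit Types (a b c h k p q x y : A) (r s t e : R).

Definition pos h := star h = h /\ exists2 t, 0 <= t & rnorm (cst t - h) <= t.

Lemma rnorm_sqr x : star x = x -> rnorm (x * x) = rnorm x ^+ 2.
Proof. by move=> sx; rewrite -rnorm_starM sx. Qed.

Lemma scale_rK r a : r != 0 -> r%:C *: (r^-1%:C *: a) = a.
Proof. by move=> r0; rewrite scalerA -rmorphM mulfV // rmorph1 scale1r. Qed.

Lemma scale_sqr r a : 0 <= r ->
  ((Num.sqrt r)%:C *: a) * ((Num.sqrt r)%:C *: a) = r%:C *: (a * a).
Proof.
by move=> r0; rewrite cs_scaleAl cs_scaleAr scalerA -rmorphM -expr2 sqr_sqrtr.
Qed.

(** Put x' = x / sqrt t and let y be a root of 1 - x'^2 commuting with x'. Then |y|^2 <= |y^2 +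
    x'^2| <= 1, while t - x^2 = t y^2. *)
Lemma rnorm_cstB_sqr x t : star x = x -> rnorm x ^+ 2 < t ->
  rnorm (cst t - x * x) <= t.
Proof.
move=> sx xt; have t0 : 0 < t by apply: le_lt_trans xt; rewrite exprn_ge0 ?rnorm_ge0.
have ti0 : 0 <= t^-1 by rewrite invr_ge0 ltW.
pose x' := (Num.sqrt t^-1)%:C *: x.
have xx' : x' * x' = (t^-1)%:C *: (x * x) by rewrite scale_sqr.
have sx' : star x' = x' by rewrite starZr sx.
have [||y [sy yy cy]] := @sqrt_1B _ _ (x' * x').
- by rewrite starMr sx'.
- rewrite xx' rnormZr ger0_norm // rnorm_sqr // mulrC ltr_pdivrMr // mul1r.
  exact: xt.
have xy : GRing.comm y x' by apply/commr_sym/cy/commrM; exact: commr_refl.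
have y1 : rnorm y ^+ 2 <= 1.
  by apply: le_trans (rnorm_sqr_le _ _ sy sx' xy) _; rewrite yy subrK rnorm1.
have -> : cst t - x * x = t%:C *: (y * y).
  by rewrite yy scalerBr xx' scale_rK // gt_eqF.
by rewrite rnormZr gtr0_norm // rnorm_sqr // ler_piMr // ltW.
Qed.

Lemma pos_sqrt h e : pos h -> 0 < e ->
  exists y, [/\ star y = y, y * y = h + cst e & forall c, GRing.comm c h -> GRing.comm c y].
Proof.
move=> [sh [t t0 th]] e0; have T0 : 0 < t + e by rewrite ltr_wpDl.
(* Here |k| <= t / (t + e) < 1, the strictness coming from e, and (t + e) (1 - k) = h + e. *)
pose k := ((t + e)^-1)%:C *: (cst t - h).
have [||y [sy yy cy]] := @sqrt_1B _ _ k.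
- by rewrite starZr starB star_cst sh.
- rewrite rnormZr gtr0_norm ?invr_gt0 // mulrC ltr_pdivrMr // mul1r.
  by apply: le_lt_trans th _; rewrite ltrDl.
exists ((Num.sqrt (t + e))%:C *: y); split.
- by rewrite starZr sy.
- rewrite scale_sqr 1?ltW // yy scalerBr scale_rK ?gt_eqF //.
  by rewrite -/(cst (t + e)) cstD opprB addrC addrA subrK.
- move=> c ch; apply/comm_scale/cy/comm_scale/commrB => //; exact: comm_cst.
Qed.

Lemma pos_cstB a t : star a = a -> rnorm a <= t -> pos (cst t - a).
Proof.
move=> sa at'; split; first by rewrite starB star_cst sa.
by exists t; [exact: le_trans (rnorm_ge0 a) at' | rewrite opprB addrC subrK].
Qed.

Lemma pos_cst r : 0 <= r -> pos (cst r).
Proof.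
by move=> r0; rewrite -[cst r]subr0; apply: pos_cstB; rewrite ?star0 ?rnorm0.
Qed.

Lemma posD a b : pos a -> pos b -> pos (a + b).
Proof.
move=> [sa [t t0 ta]] [sb [s s0 sb']]; split; first by rewrite starD sa sb.
exists (t + s); first exact: addr_ge0.
by rewrite cstD opprD addrACA; apply: le_trans (rnormD _ _) _; apply: lerD.
Qed.

Lemma posZ r a : 0 <= r -> pos a -> pos (r%:C *: a).
Proof.
move=> r0 [sa [t t0 ta]]; split; first by rewrite starZr sa.
exists (r * t); first exact: mulr_ge0.
by rewrite -scale_cst -scalerBr rnormZr ger0_norm // ler_wpM2l.
Qed.

(** Replaces the unknown t in [pos] by any t above the norm; this uniformity is what makes the cone
    closed. *)
Lemma pos_rnorm_cstB h t : pos h -> rnorm h < t -> rnorm (cst t - h) <= t.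
Proof.
move=> ph ht; apply: (@le_epsilon _ _ _ 1) => e e0; rewrite mul1r.
have [y [sy yy _]] := pos_sqrt _ _ ph e0.
have -> : cst t - h = cst (t + e) - y * y.
  by rewrite yy cstD opprD addrACA subrr addr0.
apply: rnorm_cstB_sqr => //; rewrite -rnorm_sqr // yy.
apply: le_lt_trans (rnormD _ _) _; apply: ltr_leD => //.
by apply: le_trans (rnorm_cst _) _; rewrite gtr0_norm.
Qed.

Lemma pos_closed : rclosed pos.
Proof.
move=> a Ha; split.
  by apply: rclosed_star => e /Ha[b [sb _] ba]; exists b.
(* One t for all approximants: those within 1 of [a] have norm below |a| + 2. *)
exists (rnorm a + 2); first by rewrite addr_ge0 ?rnorm_ge0.
apply: (@le_epsilon _ _ _ 1) => e e0; rewrite mul1r.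
have [|b pb ba] := Ha (Num.min e 1); first by rewrite lt_min e0 /=.
move: ba; rewrite le_min => /andP[be b1].
apply: le_trans (rnorm_distD b _ _) _; apply: lerD => //.
apply: pos_rnorm_cstB => //; rewrite -(subrK a b).
by apply: le_lt_trans (rnormD _ _) _; rewrite addrC ltrD2l (le_lt_trans b1) // ltr1n.
Qed.

(** Closedness for errors linear in e; the bound e <= 1 lets terms in e^2 be absorbed into K e. *)
Lemma pos_closedM a K : (forall e, 0 < e <= 1 ->
  exists2 b, pos b & rnorm (b - a) <= K * e) -> pos a.
Proof.
move=> H; apply: pos_closed => e e0.
have K1 : 0 < `|K| + 1 by rewrite ltr_wpDl.
pose d := Num.min 1 (e / (`|K| + 1)).
have d0 : 0 < d by rewrite lt_min ltr01 divr_gt0.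
have [|b pb ba] := H d; first by rewrite d0 ge_min lexx.
exists b => //; apply: le_trans ba _.
apply: (@le_trans _ _ ((`|K| + 1) * d)).
  by rewrite ler_wpM2r ?(ltW d0) // (le_trans (ler_norm K)) // lerDl.
by rewrite mulrC -ler_pdivlMr // ge_min lexx orbT.
Qed.

Lemma pos_sqr x : star x = x -> pos (x * x).
Proof.
move=> sx; split; first by rewrite starMr sx.
exists (rnorm x ^+ 2 + 1); first by rewrite addr_ge0 ?sqr_ge0.
by apply: rnorm_cstB_sqr; rewrite ?ltrDl.
Qed.

Lemma pos_sqrt_comm p q e : pos p -> pos q -> GRing.comm p q -> 0 < e ->
  exists x y, [/\ star x = x, star y = y, x * x = p + cst e, y * y = q + cst e
    & GRing.comm x y].
Proof.
move=> pp pq pqC e0.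
have [x [sx xx cx]] := pos_sqrt _ _ pp e0.
have [y [sy yy cy]] := pos_sqrt _ _ pq e0.
exists x, y; split=> //.
by apply/cy/commr_sym/cx/commr_sym.
Qed.

(** With commuting roots x, y of p + e and q + e, the square (xy)^2 = (p + e)(q + e) differs from pq
    by e (p + q + e). *)
Lemma pos_mul p q : pos p -> pos q -> GRing.comm p q -> pos (p * q).
Proof.
move=> pp pq pqC; apply: (@pos_closedM _ (rnorm p + rnorm q + 1)) => e /andP[e0 e1].
have [x [y [sx sy xx yy xy]]] := pos_sqrt_comm _ _ _ pp pq pqC e0.
exists ((x * y) * (x * y)).
  by apply: pos_sqr; rewrite starMr sx sy.
have -> : (x * y) * (x * y) = (p + cst e) * (q + cst e).
  by rewrite -xx -yy -!mulrA; congr (_ * _); rewrite !mulrA xy.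
have -> : (p + cst e) * (q + cst e) - p * q = e%:C *: (p + q + cst e).
  rewrite mulrDr mulrDl mul_cst -addrA -addrA addrC addrA subrK.
  by rewrite cst_mul -scalerDr [p + q]addrC addrA.
rewrite rnormZr gtr0_norm // [e * _]mulrC ler_wpM2r ?(ltW e0) //.
apply: le_trans (rnormD _ _) _; apply: lerD; first exact: rnormD.
by apply: le_trans (rnorm_cst _) _; rewrite gtr0_norm.
Qed.

(** * Invertibility and agreement with spectral positivity *)

Lemma pos_invertible h r : pos h -> 0 < r -> invertible (h + cst r).
Proof.
move=> [sh [t t0 th]] r0; have T0 : 0 < t + r by rewrite ltr_wpDl.
have -> : h + cst r = (t + r)%:C *: (1 - ((t + r)^-1)%:C *: (cst t - h)).
  rewrite scalerBr scale_rK ?gt_eqF // -/(cst (t + r)) cstD opprB.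
  by rewrite [RHS]addrC addrA subrK.
apply: invertible_scale; first by rewrite fmorph_eq0 gt_eqF.
apply: invertible_neumann.
rewrite rnormZr gtr0_norm ?invr_gt0 // mulrC ltr_pdivrMr // mul1r.
by apply: le_lt_trans th _; rewrite ltrDl.
Qed.

Lemma pos_scaleB1 h b r : pos h -> h * b = 1 -> b * h = 1 -> rnorm b <= r ->
  pos (r%:C *: h - 1).
Proof.
move=> ph hb bh br; have [sh _] := ph.
have -> : r%:C *: h - 1 = h * (cst r - b) by rewrite mulrBr mul_cst hb.
apply: pos_mul => //; first by apply: pos_cstB => //; exact: star_inv hb bh sh.
by apply: commrB; [exact: comm_cst | rewrite /GRing.comm hb bh].
Qed.

Lemma pos_gap h : pos h -> invertible h -> exists2 r, 0 < r & pos (h - cst r).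
Proof.
move=> ph [b [hb bh]]; have r0 : 0 < rnorm b + 1 by rewrite ltr_wpDl ?rnorm_ge0.
(* Adding 1 keeps the divisor positive even if b = 0, as in the zero algebra. *)
exists (rnorm b + 1)^-1; first by rewrite invr_gt0.
have := @pos_scaleB1 h b (rnorm b + 1) ph hb bh.
rewrite lerDl ler01 => /(_ isT) /(@posZ (rnorm b + 1)^-1 _).
rewrite invr_ge0 (ltW r0) => /(_ isT); rewrite scalerBr.
by rewrite scalerA -rmorphM mulVf ?gt_eqF // rmorph1 scale1r.
Qed.

Lemma pos_of_invertible h : star h = h ->
  (forall r, 0 < r -> invertible (h + cst r)) -> pos h.
Proof.
move=> sh invh.
pose E : set R := [set r | 0 <= r /\ pos (h + cst r)].
have E0 : E !=set0.
  exists (rnorm h); split; first exact: rnorm_ge0.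
  by rewrite addrC -[h]opprK; apply: pos_cstB; rewrite ?rnormN // starN sh.
have lbE : lbound E 0 by move=> r [].
have infE : has_inf E by split => //; exists 0.
pose m := inf E.
have m0 : 0 <= m by apply: lb_le_inf.
have pm : pos (h + cst m).
  apply: pos_closed => e e0; have [r [r0 pr] rm] := inf_adherent e0 infE.
  exists (h + cst r) => //.
  rewrite opprD addrACA subrr add0r -cstN -cstD; apply: le_trans (rnorm_cst _) _.
  have mr : m <= r by apply: ge_inf => //; exists 0.
  by rewrite ger0_norm ?subr_ge0 // lerBlDl ltW.
move: m0; rewrite le_eqVlt => /orP[/eqP m0|m0].
  by move: pm; rewrite -m0 cst0 addr0.
have [r r0 pr] := pos_gap _ pm (invh _ m0).
(* If m > 0, the gap r below h + m lets the infimum drop by [d], a contradiction; the minimum with m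
   keeps m - d nonnegative. *)
pose d := Num.min m r.
have d0 : 0 < d by rewrite lt_min m0.
have Emd : E (m - d).
  split; first by rewrite subr_ge0 ge_min lexx.
  have -> : h + cst (m - d) = (h + cst m - cst r) + cst (r - d).
    by rewrite !cstD !cstN addrA addrA subrK.
  by apply: posD pr _; apply: pos_cst; rewrite subr_ge0 ge_min lexx orbT.
have : m <= m - d by apply: ge_inf => //; exists 0.
by rewrite lerDl oppr_ge0 leNgt d0.
Qed.

Lemma pos_cspos h : pos h -> cspos h.
Proof.
move=> ph; have [sh _] := ph; split=> // z; apply: contra_notT => z0.
case: z z0 => u v; rewrite lecE /=.
have [-> /=|v0 _] := eqVneq v 0; first rewrite -ltNge => u0.
  have -> : (u +i* 0) *: (1 : A) - h = (-1) *: (h + cst (- u)).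
    by rewrite scaleN1r cstN opprB.
  apply: invertible_scale; first by rewrite oppr_eq0 oner_eq0.
  by apply: pos_invertible => //; rewrite oppr_gt0.
(* For z = u + iv with v nonzero, z - h = w + iv is a factor of (w + iv)(w - iv) = w^2 + v^2, which
   is invertible. *)
pose w := cst u - h.
have sw : star w = w by rewrite starB star_cst sh.
pose j : A := (v *i) *: (1 : A).
have zE (s : R) : (u +i* s) *: (1 : A) - h = w + (s *i) *: (1 : A).
  rewrite /w addrAC -scalerDl; congr (_ *: _ - _).
  by apply/eqP; rewrite eq_complex /= addr0 add0r !eqxx.
rewrite zE; clearbody w; apply: (@comm_invertible _ _ _ (w - j)).
  apply: commrB; last exact/comm_scale/commr1.
  by apply/commr_sym/commrD; [exact: commr_refl | exact/comm_scale/commr1].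
have -> : (w + (v *i) *: (1 : A)) * (w - j) = w * w + cst (v ^+ 2).
  rewrite -/j mulrDl !mulrBr /j !cs_scaleAl !cs_scaleAr !mul1r mulr1 addrA subrK.
  rewrite scalerA /cst -scaleNr; congr (_ + _ *: _).
  by apply/eqP; rewrite eq_complex /= !mul0r !mulr0 sub0r addr0 opprK oppr0 expr2 !eqxx.
by apply: pos_invertible; [exact: pos_sqr | rewrite exprn_even_gt0].
Qed.

Lemma cspos_pos h : cspos h -> pos h.
Proof.
move=> [sh sph]; apply: pos_of_invertible => // r r0.
apply: contrapT => ninv.
have /sph : spectrum h (- r)%:C.
  move=> inv; apply: ninv.
  have -> : h + cst r = (-1) *: ((- r)%:C *: (1 : A) - h).
    by rewrite scaleN1r opprB -/(cst (- r)) cstN opprK.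
  by apply: invertible_scale => //; rewrite oppr_eq0 oner_eq0.
by rewrite (lecR 0) oppr_ge0 leNgt r0.
Qed.

(** * Norm monotonicity and the comparison principle *)

Lemma pos_rnorm_le_cst a t : 0 <= t -> pos a -> pos (cst t - a) -> rnorm a <= t.
Proof.
(* Commuting roots of a + e and t - a + e have squares adding up to t + 2e, so |a + e| <= t + 2e;
   removing e from a costs one more e. *)
move=> t0 pa pta; apply: (@le_epsilon _ _ _ 3) => e e0.
have [|x [y [sx sy xx yy xy]]] := pos_sqrt_comm _ _ _ pa pta _ e0.
  by apply: commrB; [exact: comm_cst | exact: commr_refl].
have := rnorm_sqr_le _ _ sx sy xy.
rewrite -rnorm_sqr // xx yy addrACA [a + (_ - _)]addrC subrK -!cstD => le1.
rewrite -{1}(addrK (cst e) a); apply: le_trans (rnormD _ _) _; rewrite rnormN.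
have := rnorm_cst (A := A) (t + (e + e)); have := rnorm_cst (A := A) e.
rewrite !ger0_norm; last 2 first.
- by rewrite !addr_ge0 // ltW.
- exact: ltW.
by move: le1; lra.
Qed.

(** Compare with the scalar |b|: |b| - a = (|b| - b) + (b - a) is a sum of positive elements. *)
Lemma pos_rnorm_le a b : pos a -> pos (b - a) -> rnorm a <= rnorm b.
Proof.
move=> pa pba; apply: pos_rnorm_le_cst => //; first exact: rnorm_ge0.
have [sb _] : pos b by rewrite -(subrK a b); exact: posD.
rewrite -(subrK b (cst _)) -addrA; apply: posD => //.
exact: pos_cstB.
Qed.

(* For r > 0, c p c + r = c (p + r c^-2) c, and c^-2 is positive and invertible,
   hence bounded below by a positive scalar, so that p + r c^-2 is invertible. *)
Lemma pos_conj c p : star c = c -> invertible c -> pos p -> pos (c * p * c).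
Proof.
move=> sc [b [cb bc]] pp; have [sp _] := pp.
have sb : star b = b by exact: star_inv cb bc sc.
apply: pos_of_invertible; first by rewrite !starMr sc sp mulrA.
move=> r r0; pose q := r%:C *: (b * b).
have pq : pos q by apply: posZ (ltW r0) _; exact: pos_sqr.
have ib : invertible b by exists c.
have iq : invertible q.
  by apply: invertible_scale (invertible_mul _ _ ib ib); rewrite fmorph_eq0 gt_eqF.
have [s s0 pqs] := pos_gap _ pq iq.
have -> : c * p * c + cst r = c * (p + q) * c.
  rewrite mulrDr mulrDl; congr (_ + _).
  by rewrite cs_scaleAr cs_scaleAl mulrA cb mul1r bc.
have ic : invertible c by exists b.
apply: invertible_mul => //; apply: invertible_mul => //.
rewrite -(subrK (cst s) q) addrA; apply: pos_invertible => //.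
exact: posD.
Qed.

Lemma pos_of_rnorm_conj_le p q K : 0 <= K -> star p = p -> pos q ->
  (forall c, star c = c -> rnorm (c * p * c) <= K * rnorm (c * q * c)) ->
  pos (K%:C *: q - p).
Proof.
move=> K0 sp pq H; apply: (@pos_closedM _ K) => e /andP[e0 _].
have [y [sy yy _]] := pos_sqrt _ _ pq e0.
have iy : invertible y.
  apply: (@comm_invertible _ _ _ y); first exact: commr_refl.
  by rewrite yy; exact: pos_invertible.
have [c [yc cy]] := iy.
have sc : star c = c by exact: star_inv yc cy sy.
have ic : invertible c by exists y.
(* As c inverts y and y^2 = q + e, conjugating q = y^2 - e by c leaves 1 - e c^2, which is at most
   1. *)
have cqc : c * q * c = cst 1 - e%:C *: (c * c).
  have -> : q = y * y - cst e by rewrite yy addrK.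
  rewrite mulrBr mulrBl !mulrA cy mul1r yc cst1; congr (_ - _).
  by rewrite mul_cst cs_scaleAl.
have cqc1 : rnorm (c * q * c) <= 1.
  apply: pos_rnorm_le_cst => //; first exact: pos_conj.
  rewrite cqc opprB addrC subrK; apply: posZ (ltW e0) _; exact: pos_sqr.
have cpcK : rnorm (c * p * c) <= K.
  by apply: le_trans (H c sc) _; rewrite ler_piMr.
(* Conjugating K - c p c >= 0 back by y gives this element, at distance at most K e from the
   target. *)
exists (K%:C *: (q + cst e) - p).
  have -> : K%:C *: (q + cst e) - p = y * (cst K - c * p * c) * y.
    rewrite mulrBr mulrBl mul_cst cs_scaleAl yy; congr (_ - _).
    by rewrite !mulrA yc mul1r -mulrA cy mulr1.
  apply: pos_conj => //; apply: pos_cstB => //.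
  by rewrite !starMr sc sp mulrA.
rewrite scalerDr [_ + _ - p]addrAC [_ + K%:C *: cst e]addrC addrK.
rewrite scale_cst; apply: le_trans (rnorm_cst _) _.
by rewrite ger0_norm // mulr_ge0 // ltW.
Qed.

End Positivity.

(** * Frame sums and the module action *)

Section FrameSum.
Context {R : realType} {A : cstarAlgType R} {H : hilbertModType A}.
Implicit Types (x y : H) (c : A).

Lemma inner_scale c x : star c = c -> inner (c *: x) (c *: x) = c * inner x x * c.
Proof.
move=> sc; rewrite innerZl [inner x _]inner_star innerZl starMr sc.
by rewrite -inner_star mulrA.
Qed.

(** For y = S (c x) - c S x, moving S across the inner product gives <y, y> = <c x, S' y> - c <x, S'
    y> = 0. *)
Lemma adjointable_scale (S : H -> H) c x : adjointable S -> S (c *: x) = c *: S x.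
Proof.
move=> [S' adjS]; apply/subr0_eq/inner_eq0.
set y := _ - _; rewrite {1}/y.
have innerN u v : inner (- u : H) v = - inner u v.
  apply/eqP; rewrite -addr_eq0 -innerDl addNr.
  by apply/eqP/(@addIr _ (inner (0 : H) v)); rewrite -innerDl !add0r.
by rewrite innerDl innerN innerZl !adjS innerZl subrr.
Qed.

Lemma hnorm_sqr x : hnorm x ^+ 2 = (rnorm (inner x x))%:C.
Proof. by rewrite /hnorm sqrtCK rnormE. Qed.

Lemma pos_frame_sum (J : set nat) (T : nat -> H -> H) x :
  cvgn (frame_psum J T x) -> pos (frame_sum J T x).
Proof.
move=> Tx; apply: pos_closed => e e0; have [N HN] := limn_rnorm _ Tx _ e0.
exists (frame_psum J T x N); last exact: HN.
rewrite /frame_psum; elim/big_ind: _ => [||i _].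
- by rewrite -cst0; exact: pos_cst.
- exact: posD.
- exact/cspos_pos/inner_pos.
Qed.

Lemma frame_sum_scale (J : set nat) (T : nat -> H -> H) c x :
  (forall i, J i -> adjointable (T i)) ->
  cvgn (frame_psum J T x) -> cvgn (frame_psum J T (c *: x)) -> star c = c ->
  frame_sum J T (c *: x) = c * frame_sum J T x * c.
Proof.
move=> T_adj Tx Tcx sc; apply: subr0_eq.
(* The identity is exact for partial sums; the limit at c x contributes an error e, the conjugated
   limit at x an error |c|^2 e. *)
apply: (@rnorm_small _ _ _ (1 + rnorm c * rnorm c)) => e e0.
have [N HN] := limn_rnorm _ Tcx _ e0.
have [M HM] := limn_rnorm _ Tx _ e0.
pose n := maxn N M.
have psumZ : frame_psum J T (c *: x) n = c * frame_psum J T x n * c.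
  rewrite /frame_psum mulr_sumr mulr_suml; apply: eq_bigr => i /set_mem Ji.
  by rewrite adjointable_scale ?inner_scale //; exact: T_adj.
apply: le_trans (rnorm_distD (frame_psum J T (c *: x) n) _ _) _.
rewrite mulrDl mul1r; apply: lerD.
  by rewrite rnorm_distC; apply: HN; rewrite leq_maxl.
rewrite psumZ -mulrBl -mulrBr; apply: le_trans (rnormM _ _) _.
rewrite mulrAC ler_wpM2r ?rnorm_ge0 //; apply: le_trans (rnormM _ _) _.
by rewrite ler_wpM2l ?rnorm_ge0 //; apply: HM; rewrite leq_maxr.
Qed.

End FrameSum.

Theorem theorem2p3 (R : realType) (A : cstarAlgType R) (H : hilbertModType A)
    (J : set nat) (T : nat -> H -> H)
    (T_adj : forall i, J i -> adjointable (T i))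
    (T_cvg : forall x : H, cvgn (frame_psum J T x)) :
  operator_frame J T <->
  exists a b : R, [/\ 0 < a, 0 < b &
    forall x : H, a%:C * hnorm x ^+ 2 <= `|frame_sum J T x| /\
                  `|frame_sum J T x| <= b%:C * hnorm x ^+ 2].
Proof.
have posI (x : H) : pos (inner x x) by exact/cspos_pos/inner_pos.
have pos_sum x := pos_frame_sum _ _ _ (T_cvg x).
split.
- move=> [_ _ [a [b [a0 b0 ab]]]]; exists a, b; split=> // x.
  have [/cspos_pos lo /cspos_pos up] := ab x.
  rewrite hnorm_sqr rnormE -!rmorphM /= !lecR.
  rewrite -{1}(gtr0_norm a0) -{1}(gtr0_norm b0) -!rnormZr.
  split; apply: pos_rnorm_le => //; apply: posZ => //; exact: ltW.
move=> [a [b [a0 b0 ab]]]; split=> //.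
have {}ab (x : H) : a * rnorm (inner x x) <= rnorm (frame_sum J T x) /\
    rnorm (frame_sum J T x) <= b * rnorm (inner x x).
  by have := ab x; rewrite hnorm_sqr rnormE -!rmorphM /= !lecR.
exists a, b; split=> // x; split; apply: pos_cspos.
(* Factoring out [a] gives the comparison principle with K = 1/a, p = <x,x> and q the frame sum; the
   norm hypothesis is used at c x. *)
- have -> : frame_sum J T x - a%:C *: inner x x =
      a%:C *: ((a^-1)%:C *: frame_sum J T x - inner x x).
    by rewrite scalerBr scale_rK // gt_eqF.
  apply: posZ (ltW a0) _.
  apply: pos_of_rnorm_conj_le => [|||c sc]; [by rewrite invr_ge0 ltW | | exact: pos_sum |].
    by have [] := posI x.
  rewrite -inner_scale // -frame_sum_scale // mulrC ler_pdivlMr // mulrC.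
  by have [] := ab (c *: x).
(* The roles are exchanged, with K = b. *)
- apply: pos_of_rnorm_conj_le => [||//|c sc]; first exact: ltW.
    by have [] := pos_sum x.
  by rewrite -inner_scale // -frame_sum_scale //; have [] := ab (c *: x).
Qed.
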